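(* Let $G$ be a connected $k$-transmission regular graph with $n$ vertices and $m$ edges. Then $$HS(G)\ \le\ \frac{m}{2(n-1)-\frac{2m}{n}},$$ with equality if and only if $\mathrm{diam}(G)\le 2$.
   Context: All graphs are finite and simple. $d(u,v)$ is the graph distance; the transmission of $v$ is $\sigma(v)=\sum_{u\in V(G)}d(v,u)$; $\mathrm{diam}(G)$ is the maximum distance between two vertices. $G$ is $k$-transmission regular, where $k$ is a positive integer, if $\sigma(v)=k$ for every vertex $v$. The transmission harmonic index is $HS(G)=\sum_{uv\in E(G)}\frac{2}{\sigma(u)+\sigma(v)}$. *)

(* Defs.v *)
From HB Require Import structures.
From mathcomp Require Import all_boot all_order all_algebra.

Set Implicit Arguments.
Unset Strict Implicit.
Unset Printing Implicit Defensive.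

Import Order.TTheory GRing.Theory Num.Theory.

Record sgraph := SGraph {
  vertex :> finType;
  adj : rel vertex;
  adj_sym : symmetric adj;
  adj_irrefl : irreflexive adj
}.

Definition edges (G : sgraph) : {set {set G}} :=
  [set [set uv.1; uv.2] | uv : G * G & adj uv.1 uv.2].

Definition is_connected (G : sgraph) : Prop :=
  0 < #|G| /\ forall u v : G, connect (@adj G) u v.

Definition has_walk (G : sgraph) (u v : G) (k : nat) : bool :=
  [exists p : k.-tuple G, path (@adj G) u p && (last u p == v)].

(* A shortest walk repeats no vertex, so lengths below #|G| suffice. By
   convention the distance between vertices of distinct components is #|G|. *)
Definition gdist (G : sgraph) (u v : G) : nat :=
  \big[minn/#|G|]_(k < #|G| | has_walk u v k) k.

Definition transmission (G : sgraph) (v : G) : nat := \sum_(u : G) gdist v u.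

Definition diam (G : sgraph) : nat := \max_(u : G) \max_(v : G) gdist u v.

Definition transmission_regular (G : sgraph) (k : nat) : Prop :=
  0 < k /\ forall v : G, transmission v = k.

Local Open Scope ring_scope.

(* An edge E is the set of its two distinct endpoints u and v, so the inner sum
   is transmission u + transmission v. *)
Definition HS (R : realFieldType) (G : sgraph) : R :=
  \sum_(E in edges G) 2 / (\sum_(w in E) transmission w)%N%:R.

(* Main.v *)
Require Import Defs.
From mathcomp Require Import all_boot all_order all_algebra.
From mathcomp Require Import zify.

(** Every edge of a [k]-transmission regular graph contributes [2 / (k + k)] to
    the index, so [HS G = m / k], and the whole question is how small [k] can
    be.  Distinct non-adjacent vertices are at distance at least [2], hence for
    every ordered pair [(u, v)]
<<
      2 * [u != v] <= d(u, v) + [u ~ v],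
>>
    and equality holds exactly when [d(u, v) <= 2] ([pair_distance_bound]).
    Summing over all ordered pairs, where the distances add up to [n * k] and
    the adjacencies to [2 * m] ([handshake]), gives
<<
      2 * n * (n - 1) <= n * k + 2 * m,
>>
    with equality exactly when the diameter is at most [2]
    ([transmission_sum_bound]).  Dividing by [n], the right-hand denominator
    [D = 2 * (n - 1) - 2 * m / n] satisfies [D <= k].

    The map [x |-> m / x] is then applied to [D <= k].  This needs [D > 0],
    which holds because [2 * m <= n * (n - 1)] makes [D >= n - 1], and, for the
    equality case, [m > 0]: since [k > 0] excludes the one-vertex graph,
    connectedness provides an edge ([edges_gt0]). *)

Set Implicit Arguments.
Unset Strict Implicit.
Unset Printing Implicit Defensive.

Import Order.TTheory GRing.Theory Num.Theory.

Section Distance.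

Variable G : sgraph.
Implicit Types u v : G.

Lemma gdist_le u v j : j < #|G| -> has_walk u v j -> gdist u v <= j.
Proof.
move=> lt_jG walk_j; rewrite /gdist -minEnat -leEnat.
exact: (@bigmin_le_cond _ _ _ _ (Ordinal lt_jG) _ (fun i : 'I_#|G| => nat_of_ord i)).
Qed.

Lemma leq_gdist u v d : d <= #|G| ->
  (forall j, has_walk u v j -> d <= j) -> d <= gdist u v.
Proof.
move=> le_dG le_d; rewrite /gdist; elim/big_ind: _ => // [x y dx dy|j /le_d //].
by rewrite leq_min dx.
Qed.

Lemma has_walk0 u v : has_walk u v 0 = (u == v).
Proof.
apply/existsP/idP => [[p]|uv]; first by rewrite tuple0.
by exists [tuple].
Qed.

Lemma has_walk1 u v : has_walk u v 1 = adj u v.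
Proof.
apply/existsP/idP => [[[[|x []] //= _]]|uv].
  by rewrite andbT => /andP[ux /eqP <-].
by exists [tuple v]; rewrite /= uv eqxx.
Qed.

Lemma card_gt1_neq u v : u != v -> 1 < #|G|.
Proof. by move=> uv; have := max_card [set u; v]; rewrite cards2 uv. Qed.

Lemma gdistxx u : gdist u u = 0.
Proof.
have G0 : 0 < #|G| by apply/card_gt0P; exists u.
by apply/eqP; rewrite -leqn0 gdist_le // has_walk0.
Qed.

Lemma adj_neq u v : adj u v -> u != v.
Proof. by apply: contraTneq => ->; rewrite adj_irrefl. Qed.

Lemma gdist_gt0 u v : u != v -> 0 < gdist u v.
Proof.
move=> uv; apply: leq_gdist => [|[|j] //]; first exact: ltnW (card_gt1_neq uv).
by rewrite has_walk0 (negPf uv).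
Qed.

Lemma gdist_adj u v : adj u v -> gdist u v = 1.
Proof.
move=> uv; have neq_uv := adj_neq uv.
apply/eqP; rewrite eqn_leq gdist_gt0 // andbT.
by rewrite gdist_le ?has_walk1 // (card_gt1_neq neq_uv).
Qed.

(** Walks from [u] to [v] have length at least [2]; if there are none, the
    distance is [#|G|], which is at least [2] because [u != v]. *)
Lemma gdist_gt1 u v : u != v -> ~~ adj u v -> 1 < gdist u v.
Proof.
move=> uv nadj; apply: leq_gdist => [|[|[|j]] //]; first exact: card_gt1_neq uv.
  by rewrite has_walk0 (negPf uv).
by rewrite has_walk1 (negPf nadj).
Qed.

(** For fixed [u != v], the right-hand side is [1 + 1] when [u] and [v] are
    adjacent, and [d(u, v) >= 2] otherwise. *)
Lemma pair_distance_bound u v :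
  2 * (u != v) <= gdist u v + adj u v ?= iff (gdist u v <= 2).
Proof.
have [<-|uv] := eqVneq u v; first by rewrite gdistxx adj_irrefl.
have [auv|nauv] := boolP (adj u v); first by rewrite gdist_adj.
have := gdist_gt1 uv nauv; rewrite addn0 muln1 => d_gt1.
by split=> //; rewrite eqn_leq d_gt1.
Qed.

Lemma diam_le d : (diam G <= d) = [forall u : G, forall v : G, gdist u v <= d].
Proof.
apply/bigmax_leqP/forallP => [D u|D u _].
  by apply/forallP => v; move/bigmax_leqP: (D u isT); apply.
by apply/bigmax_leqP => v _; move/forallP: (D u).
Qed.

End Distance.

Section Edges.

Variable G : sgraph.
Implicit Types u v : G.

Lemma edgesP (E : {set G}) :
  reflect (exists u v, adj u v /\ E = [set u; v]) (E \in edges G).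
Proof.
apply: (iffP imsetP) => [[[u v] /= uv ->]|[u [v [uv ->]]]].
  by rewrite inE in uv; exists u, v.
by exists (u, v); rewrite ?inE.
Qed.

Lemma set2_eq (T : finType) (a b x y : T) :
  ([set x; y] == [set a; b]) = ((x, y) \in [set (a, b); (b, a)]).
Proof.
rewrite !inE !xpair_eqE.
apply/eqP/orP => [/setP E|[] /andP[/eqP-> /eqP->] //]; last exact: setUC.
move: (E x) (E y) (E a) (E b); rewrite !inE !eqxx !orbT /= !(eq_sym _ x) !(eq_sym _ y).
by case: (x == a); case: (x == b); case: (y == a); case: (y == b); rewrite ?orbT; auto.
Qed.

(** Each edge is the unordered support of exactly two adjacent ordered
    pairs. *)
Lemma handshake : \sum_(u : G) \sum_(v : G) adj u v = 2 * #|edges G|.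
Proof.
rewrite pair_big /= -big_mkcond /=.
rewrite (partition_big_imset (fun uv : G * G => [set uv.1; uv.2])) /=.
rewrite (eq_bigl (mem (edges G))) => [|E]; last first.
  apply/imsetP/edgesP => [[[u v] uv ->]|[u [v [uv ->]]]].
    by exists u, v.
  by exists (u, v).
rewrite mulnC -sum_nat_const.
apply: eq_bigr => E /edgesP[a [b [ab ->]]].
have neq_ab : (a, b) != (b, a) by rewrite xpair_eqE negb_and adj_neq.
rewrite sum1_card.
have <- : #|[set (a, b); (b, a)]| = 2 by rewrite cards2 neq_ab.
apply: eq_card => -[x y]; rewrite unfold_in /= set2_eq.
case: (boolP (_ \in [set _; _])) => [|_]; last by rewrite andbF.
rewrite !inE !xpair_eqE andbT unfold_in.
by move=> /orP[] /andP[/eqP-> /eqP->]; rewrite //= adj_sym.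
Qed.

Lemma sum_neq : \sum_(u : G) \sum_(v : G) (u != v) = #|G| * #|G|.-1.
Proof.
rewrite -sum_nat_const; apply: eq_bigr => u _.
rewrite -big_mkcond sum1_card -(cardC1 u).
by apply: eq_card => v; rewrite !inE unfold_in eq_sym.
Qed.

Lemma edges_le : 2 * #|edges G| <= #|G| * #|G|.-1.
Proof.
rewrite -handshake -sum_neq; apply: leq_sum => u _; apply: leq_sum => v _.
by case: (boolP (adj u v)) => // /adj_neq ->.
Qed.

Lemma transmission_sum_bound k : (forall v : G, transmission v = k) ->
  2 * (#|G| * #|G|.-1) <= #|G| * k + 2 * #|edges G| ?= iff (diam G <= 2).
Proof.
move=> reg; rewrite -handshake -sum_neq diam_le big_distrr /=.
have -> : #|G| * k = \sum_(u : G) \sum_(v : G) gdist u v.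
  by rewrite -sum_nat_const; apply: eq_bigr => u _; rewrite -(reg u).
rewrite -big_split /=; apply: leqif_sum => u _.
rewrite big_distrr -big_split /=; apply: leqif_sum => v _.
exact: pair_distance_bound.
Qed.

(** A one-vertex graph has zero transmissions. *)
Lemma regular_card_gt1 k : 0 < #|G| -> transmission_regular G k -> 1 < #|G|.
Proof.
move=> G_gt0 [k_gt0 reg]; rewrite ltnNge; apply: contraTN k_gt0 => G_le1.
have /card_gt0P[v _] := G_gt0.
rewrite -(reg v) /transmission big1 // => u _.
by rewrite (fintype_le1P G_le1 u v) gdistxx.
Qed.

Lemma edges_gt0 : is_connected G -> 1 < #|G| -> 0 < #|edges G|.
Proof.
move=> [_ conn] /card_gt1P[u [v [_ _ uv]]].
have /connectP[[|w p] /= path_p v_last] := conn u v.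
  by rewrite v_last eqxx in uv.
apply/card_gt0P; exists [set u; w]; apply/edgesP; exists u, w.
by case/andP: path_p.
Qed.

Lemma HS_regular (R : realFieldType) k : transmission_regular G k ->
  HS R G = (#|edges G|%:R / k%:R)%R.
Proof.
move=> [k_gt0 reg]; rewrite /HS mulr_natl -sumr_const.
apply: eq_bigr => E /edgesP[a [b [/adj_neq ab ->]]].
rewrite big_setU1 ?inE //= big_set1 !reg addnn -mul2n natrM invfM mulrA.
by rewrite divff ?mul1r // pnatr_eq0.
Qed.

End Edges.

Local Open Scope ring_scope.

Theorem lemma12 (R : realFieldType) (G : sgraph) (k n m : nat)
    (G_connected : is_connected G) (G_regular : transmission_regular G k)
    (n_vertices : #|G| = n) (m_edges : #|edges G| = m) :
  HS R G <= m%:R / (2 * (n%:R - 1) - 2 * m%:R / n%:R) /\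
  (HS R G = m%:R / (2 * (n%:R - 1) - 2 * m%:R / n%:R) <-> (diam G <= 2)%N).
Proof.
have n_gt1 := regular_card_gt1 (proj1 G_connected) G_regular.
have m_gt0 := edges_gt0 G_connected n_gt1.
have m_le := edges_le G.
have [] := transmission_sum_bound (proj2 G_regular).
have k_gt0 := proj1 G_regular.
rewrite (HS_regular R G_regular) m_edges n_vertices in n_gt1 m_gt0 m_le *.
case: n n_gt1 m_le {n_vertices} => // p p_gt0 /= m_le le_k eq_k.
set D := 2 * _ - _.
have n0 : (p.+1%:R : R) != 0 by rewrite pnatr_eq0.
have n_gt0 : 0 < (p.+1%:R : R) by rewrite ltr0n.
(* Multiplying by [n] turns comparisons with [D] into ones between naturals. *)
have nD : p.+1%:R * D + (2 * m)%:R = (2 * (p.+1 * p))%:R.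
  rewrite mulrBr [_ * (_ / _)]mulrCA divff // mulr1 -natrM subrK.
  by rewrite -[in _ - 1]natr1 addrK -!natrM mulnCA.
have D_gt0 : 0 < D.
  rewrite -(pmulr_rgt0 _ n_gt0) -(ltrD2r (2 * m)%:R) nD add0r ltr_nat.
  by nia.
have k_pos : 0 < (k%:R : R) by rewrite ltr0n.
have m_pos : 0 < (m%:R : R) by rewrite ltr0n.
have D_le : D <= k%:R.
  by rewrite -(ler_pM2l n_gt0) -(lerD2r (2 * m)%:R) nD -natrM -natrD ler_nat.
have D_eq : (D == k%:R) = (diam G <= 2)%N.
  rewrite -eq_k -(eqr_nat R) -nD [in RHS]natrD (inj_eq (addIr _)).
  by rewrite natrM (inj_eq (mulfI n0)).
split; first by rewrite ler_pM2l // lef_pV2.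
rewrite -D_eq; split=> [/(mulfI (lt0r_neq0 m_pos))/invr_inj->|/eqP-> //].
exact: eqxx.
Qed.
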